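(* Suppose that $\Lambda$ is a left hereditary ring such that: (a) $\Lambda$ has the descending chain condition on direct summands of the left module ${}_{\Lambda}\Lambda$, and (b) the injective envelope of ${}_{\Lambda}\Lambda$ is not projective. Then there is a nonzero projective $\Lambda$-module with a stable injective envelope.
   Context: Rings are associative with identity; modules are left modules. A module is stable if it has no nonzero projective direct summands. *)

(* Defs.v *)
From HB Require Import structures.
From mathcomp Require Import all_boot all_order all_algebra.

Set Implicit Arguments.
Unset Strict Implicit.
Unset Printing Implicit Defensive.

Import GRing.Theory.
Local Open Scope ring_scope.

(* [R^o] is [R] as a left module over itself, so a [submodClosed R^o] is a    *)
(* left ideal.  Submodules are boolean predicates; classically every subset   *)
(* is one.                                                                    *)

(* A submodule of [V], regarded as a module in its own right. *)
Record submodule_of (R : pzRingType) (V : lmodType R) (S : submodClosed V) :=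
  Submodule { submodule_val : V; _ : submodule_val \in S }.

HB.instance Definition _ (R : pzRingType) (V : lmodType R) (S : submodClosed V) :=
  [isSub for @submodule_val R V S].
HB.instance Definition _ (R : pzRingType) (V : lmodType R) (S : submodClosed V) :=
  [Choice of submodule_of S by <:].
HB.instance Definition _ (R : pzRingType) (V : lmodType R) (S : submodClosed V) :=
  [SubChoice_isSubLmodule of submodule_of S by <:].

Definition projective_module (R : pzRingType) (P : lmodType R) : Prop :=
  forall (A B : lmodType R) (g : {linear A -> B}) (f : {linear P -> B}),
    (forall b, exists a, g a = b) ->
    exists h : {linear P -> A}, forall x, g (h x) = f x.

Definition injective_module (R : pzRingType) (E : lmodType R) : Prop :=
  forall (A B : lmodType R) (i : {linear A -> B}) (f : {linear A -> E}),
    injective i ->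
    exists h : {linear B -> E}, forall x, h (i x) = f x.

Definition left_hereditary (R : pzRingType) : Prop :=
  forall I : submodClosed R^o, projective_module (submodule_of I).

Definition direct_summand (R : pzRingType) (V : lmodType R)
    (S : submodClosed V) : Prop :=
  exists T : submodClosed V,
    (forall x, x \in S -> x \in T -> x = 0) /\
    (forall x, exists s t, [/\ s \in S, t \in T & x = s + t]).

Definition dcc_direct_summands (R : pzRingType) (V : lmodType R) : Prop :=
  forall S : nat -> submodClosed V,
    (forall n, direct_summand (S n)) ->
    (forall n, {subset S n.+1 <= S n}) ->
    exists N : nat, forall n : nat, (N <= n)%N -> S n =i S N.

Definition stable (R : pzRingType) (V : lmodType R) : Prop :=
  forall S : submodClosed V,
    direct_summand S -> projective_module (submodule_of S) ->
    forall x, x \in S -> x = 0.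

Definition essential_mono (R : pzRingType) (M E : lmodType R)
    (i : {linear M -> E}) : Prop :=
  injective i /\
  forall S : submodClosed E,
    (exists2 x, x \in S & x != 0) -> exists2 m, m != 0 & i m \in S.

(* The injective envelope of [M] is taken up to isomorphism: it is any        *)
(* essential monomorphism from [M] into an injective module.                  *)
Definition is_injective_envelope (R : pzRingType) (M E : lmodType R)
    (i : {linear M -> E}) : Prop :=
  injective_module E /\ essential_mono i.

(* Main.v *)
(* Let E be the injective envelope of Lambda.  Call a submodule U of E good   *)
(* if it is the kernel of a map from E onto a projective module and Lambda    *)
(* meets U in a direct summand of Lambda.  If some F : U -> Lambda is nonzero,*)
(* then F U and F (U :&: Lambda) are left ideals, hence projective, so ker F  *)
(* is good again; and Lambda :&: ker F is smaller than Lambda :&: U, because  *)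
(* by essentiality Lambda meets a complement of ker F in U.  By the           *)
(* descending chain condition some good U has no nonzero map to Lambda; such  *)
(* a U is stable, since a nonzero projective module maps nontrivially to      *)
(* Lambda.  It is the injective envelope of the left ideal Lambda :&: U,      *)
(* which is nonzero since otherwise U = 0 and E would be projective.          *)

Require Import Defs.
From HB Require Import structures.
From mathcomp Require Import all_boot all_order all_algebra.
From mathcomp Require Import boolp functions.

Set Implicit Arguments.
Unset Strict Implicit.
Unset Printing Implicit Defensive.

Import GRing.Theory.
Local Open Scope ring_scope.

(** A functional on a direct summand of [E] has a left ideal as image, which is projective, so its
    kernel splits off again. Each nonzero functional peeled off strictly shrinks the trace of the
    summand on the ring, itself a summand of the ring, and the chain condition stops this. The trace
    left over is nonzero because [E] is not projective. [kernel_good] peels, [essential_off_kernel]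
    gives strictness, [dcc_minimal] the stopping point, [stable_no_functional] stability there;
    [retract_injective] and [restrict_essential] make the remainder an injective envelope of its
    trace. *)

Lemma linear_exists (R : pzRingType) (U V : lmodType R) (f : U -> V) :
  linear f -> exists g : {linear U -> V}, g =1 f.
Proof.
move=> fL; pose M := GRing.isLinear.Build R U V *:%R f fL.
pose g : {linear U -> V} := HB.pack f M.
by exists g.
Qed.

Lemma submod_exists (R : pzRingType) (V : lmodType R) (P : V -> Prop) :
  P 0 -> (forall a u v, P u -> P v -> P (a *: u + v)) ->
  exists S : submodClosed V, forall x, (x \in S) <-> P x.
Proof.
move=> P0 PL; pose S0 : V -> bool := fun x => `[< P x >].
have S0L : GRing.submod_closed S0.
  split=> [|a u v /asboolP Pu /asboolP Pv]; apply/asboolP => //.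
  exact: PL.
pose M := GRing.isSubmodClosed.Build R V S0 (GRing.submod_closed_semi S0L).
pose S : submodClosed V := HB.pack S0 M.
by exists S => x; split=> [/asboolP|Px] //; apply/asboolP.
Qed.

Lemma submod_rpredB (R : pzRingType) (V : lmodType R) (S : submodClosed V) :
  {in S &, forall u v, u - v \in S}.
Proof. by move=> u v uS vS; rewrite -scaleN1r rpredD ?rpredZ. Qed.

Lemma corestrict (R : pzRingType) (U V : lmodType R) (S : submodClosed V)
    (f : {linear U -> V}) :
  (forall x, f x \in S) ->
  exists g : {linear U -> submodule_of S}, forall x, val (g x) = f x.
Proof.
move=> fS; have [a u v|g gE] := @linear_exists R U (submodule_of S)
    (fun x => Sub (f x) (fS x)).
  by apply: val_inj; rewrite [LHS](_ : _ = f (a *: u + v)) // !linearP.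
by exists g => x; rewrite gE.
Qed.

Lemma image_exists (R : pzRingType) (U V : lmodType R) (f : {linear U -> V}) :
  exists S : submodClosed V, forall y, (y \in S) <-> exists x, y = f x.
Proof.
apply: submod_exists => [|a _ _ [x ->] [y ->]]; first by exists 0; rewrite linear0.
by exists (a *: x + y); rewrite linearP.
Qed.

(** * Projective modules, functionals and stability *)

Lemma projective_section (R : pzRingType) (A P : lmodType R)
    (g : {linear A -> P}) :
  projective_module P -> (forall y, exists x, g x = y) ->
  exists s : {linear P -> A}, cancel s g.
Proof. by move=> pP /(pP _ _ g idfun). Qed.

Lemma projective_prod (R : pzRingType) (P Q : lmodType R) :
  projective_module P -> projective_module Q -> projective_module (P * Q)%type.
Proof.
move=> pP pQ A B g f gsurj.
have [i1 i1E] : exists i : {linear P -> (P * Q)%type}, i =1 fun x => (x, 0).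
  by apply: linear_exists => a u v; apply: injective_projections; rewrite /= ?scaler0 ?addr0.
have [i2 i2E] : exists i : {linear Q -> (P * Q)%type}, i =1 fun x => (0, x).
  by apply: linear_exists => a u v; apply: injective_projections; rewrite /= ?scaler0 ?addr0.
have [h1 h1E] := pP A B g (f \o i1) gsurj.
have [h2 h2E] := pQ A B g (f \o i2) gsurj.
have [a u v|h hE] := @linear_exists R (P * Q)%type A (fun z => h1 z.1 + h2 z.2).
  by rewrite /= !linearP scalerDr addrACA.
exists h => -[x y]; rewrite hE linearD h1E h2E /= -linearD i1E i2E.
by congr (f _); apply: injective_projections; rewrite /= ?addr0 ?add0r.
Qed.

(* The map to [R] is a coordinate of a section of the canonical surjection    *)
(* from the free module on [V].  That free module is realized as the          *)
(* submodule [S] of [R^V * V] spanned by the pairs (basis vector of [x], x),  *)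
(* which makes the surjection a plain projection.                             *)
Lemma projective_nonzero_functional (R : pzRingType) (V : lmodType R) (x : V) :
  projective_module V -> x != 0 -> exists f : {linear V -> R^o}, f x != 0.
Proof.
move=> pV xn0; pose W : lmodType R := ((V -> R^o) * V)%type.
pose supp (s : seq V) (z : W) :=
  [/\ uniq s, forall t, t \notin s -> z.1 t = 0 & z.2 = \sum_(t <- s) (z.1 t : R) *: t].
have suppW s s' z : uniq s' -> {subset s <= s'} -> supp s z -> supp s' z.
  move=> us' ss' [us z0 zE]; split=> // [t ts'|].
    by apply: z0; apply: contra ts' => /ss'.
  rewrite zE [RHS](bigID (mem s)) /= [X in _ + X]big1 ?addr0; last first.
    by move=> t /z0 ->; rewrite scale0r.
  rewrite -[RHS]big_filter; apply: perm_big; apply: uniq_perm => //.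
    exact: filter_uniq.
  by move=> t; rewrite mem_filter /= andb_idr // => /ss'.
have [|a u v|S SE] := @submod_exists R W (fun z => exists s, supp s z).
- by exists [::]; split=> //=; rewrite big_nil.
- move=> [s1 su] [s2 sv]; exists (undup (s1 ++ s2)).
  have [||us u0 uE] := suppW s1 (undup (s1 ++ s2)) u _ _ su.
  + exact: undup_uniq.
  + by move=> t ts; rewrite mem_undup mem_cat ts.
  have [||_ v0 vE] := suppW s2 (undup (s1 ++ s2)) v _ _ sv.
  + exact: undup_uniq.
  + by move=> t ts; rewrite mem_undup mem_cat ts orbT.
  have E t : (a *: u + v).1 t = a *: u.1 t + v.1 t by [].
  split=> // [t ts|]; first by rewrite E u0 // v0 // scaler0 addr0.
  rewrite [LHS](_ : _ = a *: u.2 + v.2) // uE vE scaler_sumr -big_split /=.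
  by apply: eq_bigr => t _; rewrite scalerA -scalerDl.
have [g gE] : exists g : {linear submodule_of S -> V}, g =1 fun z => (val z).2.
  by apply: linear_exists => a u v; rewrite linearP.
have [y|h hK] := projective_section (g := g) pV.
  have yS : ((fun t => (t == y)%:R : R^o), y) \in S.
    apply/SE; exists [:: y]; split=> //= [t|].
      by rewrite inE => /negPf ->.
    by rewrite big_seq1 eqxx scale1r.
  by exists (Submodule yS); rewrite gE.
have [s [us h0 hE]] : exists s, supp s (val (h x)) by apply/SE; apply: valP.
have [t tn0] : exists t, (val (h x)).1 t != 0.
  apply: contrapT => nex; case/eqP: xn0.
  rewrite -(hK x) gE hE big1 // => t _.
  case: (eqVneq ((val (h x)).1 t) 0) => [->|tn0]; first by rewrite scale0r.
  by case: nex; exists t.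
have [a u v|f fE] := @linear_exists R V R^o (fun y => (val (h y)).1 t).
  by rewrite 2!linearP.
by exists f; rewrite fE.
Qed.

(** A functional that is nonzero on a projective summand extends to all of [V] by composing it with
    the projection onto that summand. *)
Lemma stable_no_functional (R : pzRingType) (V : lmodType R) :
  (forall (f : {linear V -> R^o}) x, f x = 0) -> stable V.
Proof.
move=> V0 S [T [ST0 STV]] pS x xS; apply/eqP; apply: contrapT => /negP xn0.
have [|f] := projective_nonzero_functional (x := Sub x xS : submodule_of S) pS.
  by apply: contra xn0 => /eqP/(congr1 val) /= ->.
(* The projection [p] along [T] picks the [S]-component; uniqueness of that component ([pE]) makes
   it linear. *)
have [y|p pP] := @choice V V (fun y s => s \in S /\ y - s \in T).
  have [s [t [sS tT ->]]] := STV y.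
  by exists s; rewrite (addrC s) addrK.
have pE y s : s \in S -> y - s \in T -> p y = s.
  move=> sS ysT; have [pyS ypT] := pP y; apply/eqP; rewrite -subr_eq0.
  apply/eqP/ST0; first exact: submod_rpredB.
  have -> : p y - s = (y - s) - (y - p y) by rewrite opprB [RHS]addrC addrA subrK.
  exact: submod_rpredB.
have [a u v|q qE] := @linear_exists R V V p.
  have [[uS uT] [vS vT]] := (pP u, pP v).
  apply: pE; first by rewrite rpredD ?rpredZ.
  by rewrite opprD addrACA -scalerBr rpredD ?rpredZ.
have [y|g gE] := corestrict (S := S) (f := q); first by rewrite qE; have [] := pP y.
have -> : Sub x xS = g x :> submodule_of S.
  by apply: val_inj; rewrite gE qE /= (pE x x) ?subrr ?rpred0.
by have := V0 (f \o g) x; rewrite /= => ->; rewrite eqxx.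
Qed.

(** * Retracts, direct summands and the chain condition *)

Lemma retract_injective (R : pzRingType) (E : lmodType R) (U : submodClosed E)
    (r : {linear E -> E}) :
  injective_module E -> (forall x, r x \in U) -> {in U, forall x, r x = x} ->
  injective_module (submodule_of U).
Proof.
move=> iE rU rK A B i f iinj; have [g gE] := corestrict rU.
have [h hE] := iE A B i (val \o f) iinj.
exists (g \o h) => x; apply: val_inj.
by rewrite gE hE /= rK //; apply: valP.
Qed.

Lemma idempotent_direct_summand (R : pzRingType) (V : lmodType R)
    (S : submodClosed V) (e : {linear V -> V}) :
  (forall x, e x \in S) -> {in S, forall x, e x = x} -> direct_summand S.
Proof.
move=> eS eK; have [|a u v u0 v0|T TE] := @submod_exists R V (fun x => e x = 0).
- exact: linear0.
- by rewrite linearP u0 v0 scaler0 addr0.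
exists T; split=> [x /eK ex /TE ex0|x]; first by rewrite -ex.
exists (e x), (x - e x); split=> //; last by rewrite addrC subrK.
by apply/TE; rewrite linearB /= (eK (e x)) ?subrr.
Qed.

(** Without a minimal [t], dependent choice yields a strictly descending chain of summands. The
    index [t] is kept apart from [K t] because the summands will be traces on the ring of submodules
    of [E]. *)
Lemma dcc_minimal (R : pzRingType) (V : lmodType R) (T : Type)
    (good : T -> Prop) (K : T -> submodClosed V) :
  dcc_direct_summands V -> (forall t, good t -> direct_summand (K t)) ->
  (exists t, good t) ->
  exists2 t, good t & forall t', good t' ->
    {subset K t' <= K t} -> {subset K t <= K t'}.
Proof.
move=> dcc goodK [t0 gt0]; apply: contrapT => nmin.
have step (t : {t | good t}) : exists t' : {t | good t},
    {subset K (sval t') <= K (sval t)} /\ ~ {subset K (sval t) <= K (sval t')}.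
  case: t => t gt /=; apply: contrapT => nstep; apply: nmin; exists t => // t' gt' s.
  by apply: contrapT => ns; apply: nstep; exists (exist _ t' gt').
have [nx nxP] := choice step.
pose t n : {t | good t} := iter n nx (exist _ t0 gt0).
have [n|n|N NP] := dcc (fun n => K (sval (t n))).
- by apply: goodK; apply: svalP.
- by have [] := nxP (t n).
by have [_] := nxP (t N); apply=> x; rewrite -(NP N.+1).
Qed.

(** * Peeling the image of a functional off a summand *)

Section Peeling.

Variables (R : pzRingType) (hered : left_hereditary R).

Lemma hereditary_image_section (V : lmodType R) (f : {linear V -> R^o}) :
  exists (J : submodClosed R^o) (g : {linear V -> submodule_of J})
      (s : {linear submodule_of J -> V}),
    (forall x, val (g x) = f x) /\ cancel s g.
Proof.
have [J JE] := image_exists f.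
have [x|g gE] := corestrict (S := J) (f := f); first by apply/JE; exists x.
have [y|s sK] := projective_section (g := g) (@hered J); last by exists J, g, s.
have /JE[x xE] := valP y; exists x; apply: val_inj.
by rewrite gE -xE.
Qed.

Variables (E : lmodType R) (i : {linear R^o -> E}).

(** This says that [E / U] is projective, without forming the quotient. *)
Definition coprojective (U : submodClosed E) : Prop :=
  exists (Q : lmodType R) (p : {linear E -> Q}),
    [/\ projective_module Q, forall y, exists x, p x = y
      & forall x, (x \in U) = (p x == 0)].

(** Here [e] is an idempotent whose image is the preimage of [U] under [i]. *)
Definition splits_preimage (U : submodClosed E) : Prop :=
  exists e : {linear R^o -> R^o},
    (forall x, i (e x) \in U) /\ (forall x, i x \in U -> e x = x).

Lemma coprojective_retract (U : submodClosed E) :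
  coprojective U ->
  exists r : {linear E -> E}, (forall x, r x \in U) /\ {in U, forall x, r x = x}.
Proof.
case=> Q [p [pQ psurj UE]]; have [s sK] := projective_section pQ psurj.
exists (idfun \- (s \o p)); split=> x /=; rewrite UE.
  by rewrite linearB /= sK subrr.
by move/eqP->; rewrite linear0 subr0.
Qed.

(** The quotient of [E] by [U'] is the product of [E / U] and the left ideal [F U]. On the ring, [F]
    restricted to the trace of [U] also has a left ideal as image, so its kernel splits off. *)
Lemma kernel_good (U U' : submodClosed E) (r : {linear E -> E})
    (F : {linear E -> R^o}) :
  (forall x, r x \in U) -> {in U, forall x, r x = x} ->
  (forall x, x \in U' <-> x \in U /\ F x = 0) ->
  coprojective U -> splits_preimage U -> coprojective U' /\ splits_preimage U'.
Proof.
move=> rU rK U'E [Q [p [pQ psurj UE]]] [e [eU eK]]; split.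
  have [J [g [t [gE tK]]]] := hereditary_image_section (F \o r).
  have [s sK] := projective_section pQ psurj.
  have [a u v|q qE] := @linear_exists R E (Q * submodule_of J)%type
    (fun x => (p x, g x)); first by apply: injective_projections; rewrite /= linearP.
  exists (Q * submodule_of J)%type, q; split.
  - exact: projective_prod pQ (@hered J).
  (* [s y] gives the right first coordinate; the correction lies in [U], the kernel of [p], and
     repairs only the second. *)
  - move=> [y j]; exists (s y + r (t j - s y)); rewrite qE.
    have /eqP pr0 : p (r (t j - s y)) == 0 by rewrite -UE.
    apply: injective_projections; first by rewrite linearD /= sK pr0 addr0.
    apply: val_inj; rewrite gE /= linearD /= (rK _ (rU _)) -linearD /=.
    by rewrite addrC subrK -[F _]gE tK.
  - move=> x; rewrite qE; apply/idP/eqP => [/U'E[xU Fx0]|[px0 gx0]].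
      apply: injective_projections; first by apply/eqP; rewrite -UE.
      by apply: val_inj; rewrite gE /= rK.
    have xU : x \in U by rewrite UE px0.
    by apply/U'E; split=> //; have := gE x; rewrite gx0 /= rK.
have [J [g [t [gE tK]]]] := hereditary_image_section (F \o (i \o e)).
have FE x : F (i (e x)) = val (g x) by rewrite gE.
(* Subtracting [e (t (g x))], which has the same value under [F \o i] as [e x], lands in the kernel
   of [F]. *)
exists (e \- (e \o (t \o g))); split=> x /=.
  apply/U'E; rewrite linearB /= submod_rpredB //; split=> //.
  by rewrite linearB /= !FE tK subrr.
case/U'E => ixU Fix0; have ex := eK x ixU.
have -> : g x = 0 by apply: val_inj; rewrite -FE ex Fix0.
by rewrite !linear0 addr0 ex.
Qed.

Hypothesis i_ess : essential_mono i.

(** The image [C] of [r \o t] is a complement of the kernel of [F] in [U]. It is nonzero, so it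
    meets the image of [i], and [F] is injective on it. *)
Lemma essential_off_kernel (U : submodClosed E) (r : {linear E -> E})
    (F : {linear E -> R^o}) (u : E) :
  (forall x, r x \in U) -> {in U, forall x, r x = x} ->
  u \in U -> F u != 0 -> exists x, i x \in U /\ F (i x) != 0.
Proof.
move=> rU rK uU Fun0; have [iinj iess] := i_ess.
have [J [g [t [gE tK]]]] := hereditary_image_section (F \o r).
have [C CE] := image_exists (r \o t).
have FC j : F (r (t j)) = val j by rewrite -[F _]gE tK.
have [|m mn0 /CE[j ij]] := iess C.
  exists (r (t (g u))); first by apply/CE; exists (g u).
  by apply: contra Fun0 => /eqP rtg0; rewrite -{1}(rK u uU) -[F _]gE -FC rtg0 linear0.
exists m; rewrite ij /= rU FC; split=> //.
apply: contra mn0 => /eqP j0; apply/eqP/iinj; rewrite ij linear0.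
by rewrite (_ : j = 0) ?linear0 //; apply: val_inj.
Qed.

(** A nonzero submodule of [U] is one of [E], so it meets the image of [i], necessarily at a point
    coming from [K]. *)
Lemma restrict_essential (U : submodClosed E) (K : submodClosed R^o) :
  (forall x, (x \in K) = (i x \in U)) ->
  exists j : {linear submodule_of K -> submodule_of U}, essential_mono j.
Proof.
move=> KE; have [iinj iess] := i_ess.
have [x|j jE] := @corestrict R _ _ U (i \o (val : submodule_of K -> R^o)).
  by rewrite /= -KE; apply: valP.
exists j; split=> [x y /(congr1 val)|S [x xS xn0]].
  by rewrite !jE => /iinj/val_inj.
have [|a _ _ [u uS ->] [v vS ->]|S' S'E] := @submod_exists R E
  (fun y => exists2 u, u \in S & y = val u).
- by exists 0; rewrite ?rpred0.
- by exists (a *: u + v); rewrite ?rpredD ?rpredZ // linearP.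
have [|m mn0 /S'E[u uS iu]] := iess S'.
  by exists (val x); [apply/S'E; exists x | apply: contra xn0 => /eqP x0; apply/eqP/val_inj].
have mK : m \in K by rewrite KE iu; apply: valP.
exists (Sub m mK); first by apply: contra mn0 => /eqP/(congr1 val)/= ->.
by rewrite (_ : j _ = u) //; apply: val_inj; rewrite jE.
Qed.

End Peeling.

Theorem theorem8p12 (Lambda : pzRingType)
  (hered : left_hereditary Lambda)
  (ha : dcc_direct_summands (Lambda^o : lmodType Lambda))
  (hb : exists (E : lmodType Lambda) (i : {linear Lambda^o -> E}),
      is_injective_envelope i /\ ~ projective_module E) :
  exists P : lmodType Lambda,
    [/\ exists x : P, x != 0,
        projective_module P &
        exists (E : lmodType Lambda) (i : {linear P -> E}),
          is_injective_envelope i /\ stable E].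
Proof.
have [E [i [[injE i_ess] nprojE]]] := hb.
have preimage (U : submodClosed E) : exists K : submodClosed Lambda^o,
    forall x, (x \in K) = (i x \in U).
  have [|a u v uU vU|K KE] := @submod_exists _ Lambda^o (fun x => i x \in U).
  - by rewrite linear0 rpred0.
  - by rewrite linearP rpredD ?rpredZ.
  by exists K => x; apply/idP/idP => /KE.
have [K KE] := choice preimage.
have [U [cU sU] Umin] : exists2 U, coprojective U /\ splits_preimage i U &
    forall U', coprojective U' /\ splits_preimage i U' ->
      {subset K U' <= K U} -> {subset K U <= K U'}.
  apply: dcc_minimal ha _ _ => [U [_ [e [eU eK]]]|].
    by apply: (idempotent_direct_summand (e := e)) => x; rewrite KE //; apply: eK.
  (* The search starts from [U = E], with the zero module as projective quotient. *)
  have [//|//|U UE] := @submod_exists _ E (fun=> True).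
  have inU x : x \in U by apply/UE.
  exists U; split; last by exists idfun.
  have [//|a u v -> ->|Z ZE] := @submod_exists _ E (fun x => x = 0).
    by rewrite scaler0 addr0.
  have Z0 (z : submodule_of Z) : z = 0 by apply/val_inj/ZE/valP.
  exists (submodule_of Z), \0; split=> [A B g f _|y|x].
  - by exists \0 => x; rewrite (Z0 x) !linear0.
  - by exists 0; rewrite (Z0 y).
  - by rewrite inU eqxx.
have [r [rU rK]] := coprojective_retract cU.
exists (submodule_of (K U)); split.
- apply: contrapT => K0; apply: nprojE.
  have U0 x : x \in U -> x = 0.
    move=> xU; apply/eqP; apply: contrapT => /negP xn0.
    have [|m mn0 imU] := i_ess.2 U; first by exists x.
    have mK : m \in K U by rewrite KE.
    by apply: K0; exists (Sub m mK); apply: contra mn0 => /eqP/(congr1 val)/= ->.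
  have [Q [p [pQ psurj UE]]] := cU => A B g f gsurj.
  have [s sK] := projective_section pQ psurj.
  have [h hE] := pQ A B g (f \o s) gsurj.
  exists (h \o p) => x; rewrite /= hE /=; congr (f _); apply/eqP.
  by rewrite -subr_eq0; apply/eqP/U0; rewrite UE linearB /= sK subrr.
- exact: hered.
have [j j_ess] := restrict_essential i_ess (KE U).
exists (submodule_of U), j; split; first by split=> //; apply: retract_injective rU rK.
apply: stable_no_functional => f x; apply/eqP; apply: contrapT => /negP fxn0.
(* The functional [f] on [U] is extended to [E] through the retraction, the form [kernel_good]
   needs. *)
have [q qE] := corestrict rU; pose F : {linear E -> Lambda^o} := f \o q.
have Fx : F (val x) != 0.
  by rewrite /F /= (_ : q _ = x) //; apply: val_inj; rewrite qE rK //; apply: valP.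
have [y [iyU Fiy]] := essential_off_kernel hered i_ess rU rK (valP x) Fx.
have [|a u v [uU Fu] [vU Fv]|U' U'E] := @submod_exists _ E
  (fun x => x \in U /\ F x = 0).
- by rewrite rpred0 linear0.
- by rewrite rpredD ?rpredZ // linearP Fu Fv scaler0 addr0.
(* Minimality of [U] would force [y] into the kernel of [F \o i], against the choice of [y]. *)
have: y \in K U'.
  apply: (Umin U' (kernel_good hered rU rK U'E cU sU)); last by rewrite KE.
  by move=> z; rewrite !KE => /U'E[].
by rewrite KE => /U'E[_ Fiy0]; rewrite Fiy0 eqxx in Fiy.
Qed.
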